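(* Let $d\ge 1$, let $b_1,\dots,b_d\in\mathbb{C}$ and let $p(\lambda)=\prod_{j=1}^d(1+b_j\lambda)=1+\sum_{j=1}^d a_j\lambda^j$. Assume that $$\operatorname{var}(\operatorname{Im} b_1,\dots,\operatorname{Im} b_d)\le (d-1)\bigl(\operatorname{mean}(\operatorname{Im} b_1,\dots,\operatorname{Im} b_d)\bigr)^2 .$$ Then $$|p(\lambda)|\le \exp\Bigl(\operatorname{Re}(a_1\lambda)+\tfrac12\bigl(|a_1|^2-2\operatorname{Re}a_2\bigr)|\lambda|^2\Bigr)\qquad\text{for all }\lambda\in\mathbb{C}.$$
   Context: For real numbers $x_1,\dots,x_d$: $\operatorname{mean}(x_1,\dots,x_d)=\frac1d\sum_{j=1}^d x_j=:m$ and $\operatorname{var}(x_1,\dots,x_d)=\frac1d\sum_{j=1}^d(x_j-m)^2$. With these conventions the hypothesis is equivalent to $\sum_{1\le j<k\le d}\operatorname{Im}b_j\operatorname{Im}b_k\ge 0$. Here $a_1,a_2$ are the coefficients of $\lambda,\lambda^2$ in $p$ (so $a_2=0$ if $d=1$). *)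

(* Defs.v *)
From HB Require Import structures.
From mathcomp Require Import all_boot all_order all_algebra.
From mathcomp Require Import reals.

Set Implicit Arguments.
Unset Strict Implicit.
Unset Printing Implicit Defensive.

Import Order.TTheory GRing.Theory Num.Theory.
Local Open Scope ring_scope.

Definition mean (R : realType) (d : nat) (x : 'I_d -> R) : R :=
  (\sum_(j < d) x j) / d%:R.

Definition var (R : realType) (d : nat) (x : 'I_d -> R) : R :=
  (\sum_(j < d) (x j - mean x) ^+ 2) / d%:R.

(* Main.v *)
Require Import Defs.
From HB Require Import structures.
From mathcomp Require Import all_boot all_order all_algebra.
From mathcomp Require Import reals sequences exp.
From mathcomp Require Import complex.
From mathcomp Require Import ring lra.

(** Write [b j = x j + i y j].  The elementary bound [1 + t <= exp t], applied to
    [|1 + b j lambda|^2 = 1 + 2 Re (b j lambda) + |b j|^2 |lambda|^2], gives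
    [|1 + b j lambda| <= exp (Re (b j lambda) + |b j|^2 |lambda|^2 / 2)]
    ([normc_1D_le_expR]), and hence
    [|p lambda| <= exp (Re (a1 lambda) + (sum_j |b j|^2) |lambda|^2 / 2)].

    It remains to compare [sum_j |b j|^2] with [|a1|^2 - 2 Re a2].  Newton's
    identity [a1^2 = sum_j (b j)^2 + 2 a2] ([newton2_prod_linear]) together with
    [|z|^2 = Re (z^2) + 2 (Im z)^2], used for [z = a1] and for each [z = b j],
    gives
    [|a1|^2 - 2 Re a2 = sum_j |b j|^2 + 2 ((sum_j y j)^2 - sum_j (y j)^2)].
    The variance hypothesis says exactly that the last bracket, which is twice
    the second elementary symmetric function of the [y j], is nonnegative
    ([sum_sqr_le_sqr_sum]). *)

Set Implicit Arguments.
Unset Strict Implicit.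
Unset Printing Implicit Defensive.

Import Order.TTheory GRing.Theory Num.Theory.
Local Open Scope ring_scope.

Section LowCoefficients.
Variables (A : comNzRingType) (I : Type) (b : I -> A).
Implicit Type r : seq I.

Lemma coefS_mul_linear (c : A) (q : {poly A}) (k : nat) :
  ((1 + c *: 'X) * q)`_k.+1 = q`_k.+1 + c * q`_k.
Proof. by rewrite mulrDl mul1r -scalerAl coefD coefZ coefXM. Qed.

Lemma horner_prod_linear r (x : A) :
  (\prod_(j <- r) (1 + b j *: 'X)).[x] = \prod_(j <- r) (1 + b j * x).
Proof. by rewrite horner_prod; apply: eq_bigr => j _; rewrite !hornerE. Qed.

Lemma coef0_prod_linear r : (\prod_(j <- r) (1 + b j *: 'X))`_0 = 1.
Proof.
by rewrite -horner_coef0 horner_prod_linear big1 // => j _; rewrite mulr0 addr0.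
Qed.

Lemma coef1_prod_linear r :
  (\prod_(j <- r) (1 + b j *: 'X))`_1 = \sum_(j <- r) b j.
Proof.
elim: r => [|j r IHr]; first by rewrite !big_nil coef1.
by rewrite !big_cons coefS_mul_linear IHr coef0_prod_linear mulr1 addrC.
Qed.

(** Newton's identity [e1^2 = p2 + 2 e2]. *)
Lemma newton2_prod_linear r :
  (\sum_(j <- r) b j) ^+ 2 =
  \sum_(j <- r) b j ^+ 2 + 2 * (\prod_(j <- r) (1 + b j *: 'X))`_2.
Proof.
elim: r => [|j r IHr]; first by rewrite !big_nil coef1 expr0n mulr0 addr0.
rewrite !big_cons coefS_mul_linear coef1_prod_linear sqrrD IHr.
by ring.
Qed.

End LowCoefficients.

Section ComplexCoordinates.
Variable R : realType.
Implicit Types z w : R[i].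

Lemma sqr_normc z : Normc.normc z ^+ 2 = complex.Re z ^+ 2 + complex.Im z ^+ 2.
Proof. by case: z => x y /=; rewrite sqr_sqrtr // addr_ge0 ?sqr_ge0. Qed.

Lemma normc_ge0 z : 0 <= Normc.normc z.
Proof. by case: z => x y; apply: sqrtr_ge0. Qed.

Lemma ReD z w : complex.Re (z + w) = complex.Re z + complex.Re w.
Proof. by case: z; case: w. Qed.

Lemma Re_sum I (r : seq I) (F : I -> R[i]) :
  complex.Re (\sum_(j <- r) F j) = \sum_(j <- r) complex.Re (F j).
Proof. exact: (big_morph _ ReD). Qed.

Lemma Im_sum I (r : seq I) (F : I -> R[i]) :
  complex.Im (\sum_(j <- r) F j) = \sum_(j <- r) complex.Im (F j).
Proof. by apply: big_morph => // z w; case: z; case: w. Qed.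

Lemma normc_prod I (r : seq I) (F : I -> R[i]) :
  Normc.normc (\prod_(j <- r) F j) = \prod_(j <- r) Normc.normc (F j).
Proof.
apply: big_morph; first exact: Normc.normcM.
by rewrite /= expr0n addr0 expr1n sqrtr1.
Qed.

(** For [z = x + i y] this reads [x^2 + y^2 = (x^2 - y^2) + 2 y^2]; it turns
    Newton's complex identity into one between moduli and imaginary parts. *)
Lemma sqr_normcE z :
  Normc.normc z ^+ 2 = complex.Re (z ^+ 2) + 2 * complex.Im z ^+ 2.
Proof. by rewrite sqr_normc; case: z => x y /=; ring. Qed.

(** [1 + t <= exp t] for [t = 2 Re z + |z|^2], since [|1 + z|^2 = 1 + t]. *)
Lemma normc_1D_le_expR z :
  Normc.normc (1 + z) <= expR (complex.Re z + 2^-1 * Normc.normc z ^+ 2).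
Proof.
rewrite -(@ler_pXn2r _ 2) ?nnegrE ?normc_ge0 ?expR_ge0 // -expRM_natl.
apply: le_trans (expR_ge1Dx _).
rewrite !sqr_normc; case: z => x y /=; lra.
Qed.

End ComplexCoordinates.

(** In terms of [S = sum_j y j], the variance is [(sum_j (y j)^2) / d - (S / d)^2],
    so the bound [(d - 1) (S / d)^2] amounts to [(sum_j (y j)^2) / d <= S^2 / d]. *)
Lemma sum_sqr_le_sqr_sum (R : realType) (d : nat) (y : 'I_d -> R) :
  (0 < d)%N -> var y <= (d%:R - 1) * mean y ^+ 2 ->
  \sum_(j < d) y j ^+ 2 <= (\sum_(j < d) y j) ^+ 2.
Proof.
move=> d_gt0; have dR_gt0 : (0 : R) < d%:R by rewrite ltr0n.
have d_neq0 : d%:R != 0 :> R by rewrite gt_eqF.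
set m := mean y.
have sumE : \sum_(j < d) y j = m * d%:R by rewrite /m /mean divfK.
have dev : \sum_(j < d) (y j - m) ^+ 2 = \sum_(j < d) y j ^+ 2 - m ^+ 2 * d%:R.
  under eq_bigr do rewrite sqrrB -(mulr_natl _ 2).
  rewrite big_split sumrB /= sumr_const card_ord -mulr_sumr -mulr_suml sumE.
  by rewrite -(mulr_natr _ d); ring.
rewrite /var -/m dev sumE ler_pdivrMr // lerBlDr => /le_trans; apply.
by rewrite le_eqVlt; apply/orP; left; apply/eqP; ring.
Qed.

Theorem theorem3p1 (R : realType) (d : nat) (d_ge1 : (1 <= d)%N)
    (b : 'I_d -> R[i]) (p : {poly R[i]})
    (p_def : p = \prod_(j < d) (1 + b j *: 'X))
    (var_le : var (fun j => complex.Im (b j)) <=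
       (d%:R - 1) * mean (fun j => complex.Im (b j)) ^+ 2)
    (lambda : R[i]) :
  Normc.normc p.[lambda] <=
    expR (complex.Re (p`_1 * lambda) +
          2^-1 * (Normc.normc p`_1 ^+ 2 - 2 * complex.Re p`_2) *
            Normc.normc lambda ^+ 2).
Proof.
have y_le := sum_sqr_le_sqr_sum d_ge1 var_le.
have a1E : p`_1 = \sum_(j < d) b j by rewrite p_def coef1_prod_linear.
have normb_le : \sum_(j < d) Normc.normc (b j) ^+ 2 <=
    Normc.normc p`_1 ^+ 2 - 2 * complex.Re p`_2.
  have /(congr1 (@complex.Re R)) := newton2_prod_linear b (index_enum 'I_d).
  rewrite -p_def -a1E ReD Re_sum mulr_natl mulr2n ReD => newton.
  rewrite sqr_normcE newton a1E Im_sum.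
  under eq_bigr do rewrite sqr_normcE.
  by rewrite big_split -mulr_sumr /=; lra.
rewrite {1}p_def horner_prod_linear normc_prod.
apply: (@le_trans _ _ (expR (\sum_(j < d)
    (complex.Re (b j * lambda) + 2^-1 * Normc.normc (b j * lambda) ^+ 2)))).
  by rewrite expR_sum; apply: ler_prod => j _; rewrite normc_ge0 normc_1D_le_expR.
rewrite ler_expR big_split /= -Re_sum -mulr_suml -a1E lerD2l.
under eq_bigr do rewrite Normc.normcM exprMn mulrA.
by rewrite -mulr_suml -mulr_sumr ler_wpM2r ?sqr_ge0 // ler_wpM2l ?invr_ge0.
Qed.
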